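(* Let $(X_k,X_{k+1})$ be jointly Gaussian with density $\mathcal N\left(\begin{bmatrix} x_k \\ x_{k+1} \end{bmatrix}\Big|\ \mu_{k:k+1},\mathbf P_{k:k+1}\right)$, with $\mathbf P_{k:k+1}=(\mathbf P_{k:k+1}^{1/2})^T\mathbf P_{k:k+1}^{1/2}$, and let $u_k\in\mathbb R^{n_u}$, $y_k\in\mathbb R^{n_y}$ be fixed vectors. Then a square-root factor of the combined expectation over this distribution is $$\mathbb E_k\left[\begin{bmatrix} X_k \\ X_{k+1} \\ u_k \\ y_k \end{bmatrix}\begin{bmatrix} X_k \\ X_{k+1} \\ u_k \\ y_k \end{bmatrix}^T\right]^{1/2}=\begin{bmatrix}M_{11}&M_{12} \\ \mathbf 0&M_{22}\end{bmatrix},$$ where $$M_{22}=\sqrt{1-\lambda^T\lambda}\,\begin{bmatrix}u_k^T&y_k^T\end{bmatrix},\qquad M_{12}=\lambda\begin{bmatrix}u_k^T&y_k^T\end{bmatrix},\qquad \lambda=M_{11}^{-T}\mu_{k:k+1},$$ and $M_{11}=\boldsymbol{\mathcal R}$ is the ($2n_x\times 2n_x$) upper triangular factor of the Q-less QR decomposition $$\boldsymbol{\mathcal R}=\boldsymbol{\mathcal Q}\begin{bmatrix}\mathbf P_{k:k+1}^{1/2} \\ \mu_{k:k+1}^T\end{bmatrix}.$$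
   Context: $X_k,X_{k+1}$ take values in $\mathbb R^{n_x}$, $\mu_{k:k+1}\in\mathbb R^{2n_x}$, and $\mathbf P_{k:k+1}$ is a symmetric positive definite $2n_x\times 2n_x$ matrix. $\mathcal N(\cdot\mid\mu,\mathbf P)$ is the Gaussian density with mean $\mu$ and covariance $\mathbf P$, and $\mathbb E_k$ is expectation over this Gaussian ($u_k$ and $y_k$ are constants). A square-root factor of a symmetric positive semidefinite matrix $A$ is a matrix $F=A^{1/2}$ with $F^TF=A$. In a Q-less QR decomposition, $\boldsymbol{\mathcal Q}$ has been chosen orthogonal so that the product is upper triangular, with zero rows discarded; thus $\boldsymbol{\mathcal R}$ is a square upper triangular matrix with $\boldsymbol{\mathcal R}^T\boldsymbol{\mathcal R}=X^TX$ for $X$ the matrix being decomposed. $M^{-T}=(M^{-1})^T$. *)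

(* Defs.v *)
From HB Require Import structures.
From mathcomp Require Import all_boot all_order all_algebra.
From mathcomp Require Import all_classical all_reals all_analysis.

Set Implicit Arguments.
Unset Strict Implicit.
Unset Printing Implicit Defensive.

Import Order.TTheory GRing.Theory Num.Theory.
Import numFieldNormedType.Exports.

Local Open Scope classical_set_scope.
Local Open Scope ring_scope.

Definition measure_matrix_display : measure_display -> measure_display.
Proof. exact. Qed.

(* The sigma-algebra generated by the entries; on 'cV[R]_n it is the Borel
   sigma-algebra of R^n. *)
Section measurable_matrix.
Context {d} {T : measurableType d} (m n : nat).

Definition matrix_cylinders : set (set 'M[T]_(m, n)) :=
  [set B | exists i j, exists2 A : set T, measurable A &
    B = [set M : 'M[T]_(m, n) | A (M i j)]].

Definition matrix_measurable : set (set 'M[T]_(m, n)) :=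
  <<s matrix_cylinders >>.

Let matrix_set0 : matrix_measurable set0.
Proof. exact: sigma_algebra0. Qed.

Let matrix_setC A : matrix_measurable A -> matrix_measurable (~` A).
Proof. exact: sigma_algebraC. Qed.

Let matrix_bigcup (F : _^nat) : (forall i, matrix_measurable (F i)) ->
  matrix_measurable (\bigcup_i F i).
Proof. exact: sigma_algebra_bigcup. Qed.

HB.instance Definition _ := @isMeasurable.Build (measure_matrix_display d)
  'M[T]_(m, n) matrix_measurable matrix_set0 matrix_setC matrix_bigcup.

End measurable_matrix.

Lemma measurable_entry d (T : measurableType d) m n (i : 'I_m) (j : 'I_n) :
  measurable_fun [set: 'M[T]_(m, n)] (fun M => M i j).
Proof.
move=> _ A mA; rewrite setTI; apply: sub_sigma_algebra.
by exists i, j, A.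
Qed.

Lemma measurable_fun_matrixP d1 d2 (T1 : measurableType d1)
    (T2 : measurableType d2) m n (f : T1 -> 'M[T2]_(m, n)) :
  measurable_fun [set: T1] f <->
  forall i j, measurable_fun [set: T1] (fun x => f x i j).
Proof.
split=> [mf i j|mf].
  exact: measurableT_comp (@measurable_entry _ _ _ _ i j) mf.
apply: (measurability (@matrix_cylinders _ T2 m n)) => //.
by move=> _ [_ [i [j [A mA ->]]] <-]; exact: mf.
Qed.

Section lebesgue_cV.
Context {R : realType}.

Definition cons_cV n (p : R * 'cV[R]_n) : 'cV[R]_n.+1 := col_mx p.1%:M p.2.

Definition uncons_cV n (v : 'cV[R]_n.+1) : R * 'cV[R]_n :=
  (v ord0 ord0, \col_i v (lift ord0 i) ord0).

Lemma cons_cVE n (p : R * 'cV[R]_n) (i : 'I_n.+1) :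
  cons_cV p i ord0 = if unlift ord0 i is Some j then p.2 j ord0 else p.1.
Proof.
case: unliftP => [j ->|->]; rewrite /cons_cV.
  have -> : lift ord0 j = rshift 1 j by apply/val_inj.
  by rewrite (col_mxEd (p.1%:M : 'M[R]_1)).
have -> : ord0 = lshift n (ord0 : 'I_1) by apply/val_inj.
by rewrite (col_mxEu (p.1%:M : 'M[R]_1)) !mxE eqxx.
Qed.

Lemma cons_cVK n : cancel (@cons_cV n) (@uncons_cV n).
Proof.
case=> x v; rewrite /uncons_cV cons_cVE unlift_none; congr pair.
by apply/colP => i; rewrite mxE cons_cVE liftK.
Qed.

Lemma measurable_cons_cV n : measurable_fun [set: R * 'cV[R]_n] (@cons_cV n).
Proof.
apply/measurable_fun_matrixP => i j; rewrite ord1.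
under eq_fun do rewrite cons_cVE.
case: unliftP => [k _|_]; last exact: measurable_fst.
exact: measurableT_comp (@measurable_entry _ _ _ _ k ord0) measurable_snd.
Qed.

Lemma measurable_uncons_cV n :
  measurable_fun [set: 'cV[R]_n.+1] (@uncons_cV n).
Proof.
apply: measurable_fun_pair; first exact: measurable_entry.
apply/measurable_fun_matrixP => i j.
by under eq_fun do rewrite mxE; exact: measurable_entry.
Qed.

Section step.
Variables (n : nat) (m : {sigma_finite_measure set 'cV[R]_n -> \bar R}).

Definition lebesgue_cons := pushforward (lebesgue_measure \x m)%E (@cons_cV n).

Let lebesgue_cons0 : lebesgue_cons set0 = 0%E.
Proof. by rewrite /lebesgue_cons /pushforward preimage_set0 measure0. Qed.

Let lebesgue_cons_ge0 A : (0 <= lebesgue_cons A)%E.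
Proof. exact: (measure_ge0 (lebesgue_measure \x m)%E). Qed.

Let lebesgue_cons_sigma_additive : semi_sigma_additive lebesgue_cons.
Proof.
apply: measure_semi_sigma_additive.
exact: measurable_cons_cV.
Qed.

HB.instance Definition _ := isMeasure.Build _ _ _ lebesgue_cons
  lebesgue_cons0 lebesgue_cons_ge0 lebesgue_cons_sigma_additive.

Let lebesgue_cons_sigma_finite : sigma_finite setT lebesgue_cons.
Proof.
have /sigma_finiteP[F [TF ndF Foo]] := sigma_finiteT (@lebesgue_measure R).
have /sigma_finiteP[G [TG ndG Goo]] := sigma_finiteT m.
exists (fun i => @uncons_cV n @^-1` (F i `*` G i)).
  rewrite -preimage_bigcup -[LHS](preimage_setT (@uncons_cV n)).
  congr (_ @^-1` _); apply/esym/seteqP; split=> // -[x v] _.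
  have [i _ Fx] : (\bigcup_i F i) x by rewrite -TF.
  have [j _ Gv] : (\bigcup_i G i) v by rewrite -TG.
  exists (maxn i j) => //; split=> /=.
    by move: x Fx; exact/subsetPset/ndF/leq_maxl.
  by move: v Gv; exact/subsetPset/ndG/leq_maxr.
move=> i; have [mF Fi] := Foo i; have [mG Gi] := Goo i; split.
  rewrite -[X in measurable X]setTI; apply: measurable_uncons_cV => //.
  exact: measurableX.
rewrite /lebesgue_cons /pushforward -comp_preimage (_ : _ \o _ = id).
  by rewrite preimage_id product_measure1E// lte_mul_pinfty// ge0_fin_numE.
by apply/funext => p /=; rewrite cons_cVK.
Qed.

HB.instance Definition _ := Measure_isSigmaFinite.Build _ _ _ lebesgue_cons
  lebesgue_cons_sigma_finite.

End step.

Fixpoint lebesgue_cV n : {sigma_finite_measure set 'cV[R]_n -> \bar R} :=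
  match n with
  | 0 => \d_(0 : 'cV[R]_0)
  | n.+1 => lebesgue_cons (lebesgue_cV n)
  end.

Lemma lebesgue_cV_box n (A : 'I_n -> set R) :
  (forall i, measurable (A i)) ->
  lebesgue_cV n [set v | forall i, A i (v i ord0)] =
  (\prod_(i < n) lebesgue_measure (A i))%E.
Proof.
elim: n A => [|n IHn] A mA.
  by rewrite big_ord0 /= diracE mem_set// => -[].
rewrite big_ord_recl /= /lebesgue_cons /pushforward.
have -> : @cons_cV n @^-1` [set v | forall i, A i (v i ord0)] =
    A ord0 `*` [set v : 'cV[R]_n | forall i, A (lift ord0 i) (v i ord0)].
  apply/seteqP; split=> -[x v] /= H.
    by split=> [|i]; [have := H ord0|have := H (lift ord0 i)];
      rewrite cons_cVE ?unlift_none ?liftK.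
  move=> i; rewrite cons_cVE; case: unliftP => [j ->|->]; last exact: H.1.
  exact: H.2.
have mB : measurable
    [set v : 'cV[R]_n | forall i, A (lift ord0 i) (v i ord0)].
  rewrite (_ : [set v | _] =
      \bigcap_(i : 'I_n) [set v : 'cV[R]_n | A (lift ord0 i) (v i ord0)]).
    apply: fin_bigcap_measurable => [|i _]; first exact: finite_finset.
    rewrite -[X in measurable X]setTI.
    exact: (@measurable_entry _ _ _ _ i ord0).
  by apply/seteqP; split=> v /= H i //=; exact: H.
have := IHn (fun i => A (lift ord0 i)) (fun i => mA (lift ord0 i)).
move=> <-; exact: (@product_measure1E _ _ (measurableTypeR R) _ R
  lebesgue_measure (lebesgue_cV n) _ _ (mA ord0) mB).
Qed.

End lebesgue_cV.

Section gaussian.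
Context {R : realType}.

Definition posdefmx n (P : 'M[R]_n) :=
  P^T = P /\ forall v : 'cV[R]_n, v != 0 -> 0 < (v^T *m P *m v) ord0 ord0.

Definition gaussian_pdf n (mu : 'cV[R]_n) (P : 'M[R]_n) (x : 'cV[R]_n) : R :=
  expR (- ((x - mu)^T *m invmx P *m (x - mu)) ord0 ord0 / 2) /
  Num.sqrt ((pi *+ 2) ^+ n * \det P).

Definition has_density d (T : measurableType d) (Pr : probability T R) n
    (X : T -> 'cV[R]_n) (f : 'cV[R]_n -> R) :=
  forall A : set 'cV[R]_n, measurable A ->
    (Pr (X @^-1` A) = \int[lebesgue_cV n]_(x in A) (f x)%:E)%E.

Definition expectation_mx d (T : measurableType d) (Pr : probability T R) m n
    (Z : T -> 'M[R]_(m, n)) : 'M[R]_(m, n) :=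
  \matrix_(i, j) fine 'E_Pr[fun w => Z w i j].

Definition integrable_mx d (T : measurableType d) (Pr : probability T R) m n
    (Z : T -> 'M[R]_(m, n)) :=
  forall i j, Pr.-integrable [set: T] (fun w => (Z w i j)%:E).

End gaussian.

Section factorizations.
Context {R : realType}.

(* Square-root factors need not be square. *)
Definition is_sqrt_factor m n (A : 'M[R]_n) (F : 'M[R]_(m, n)) :=
  F^T *m F = A.

(* is_trig_mx is lower triangularity. The two orthogonality equations force Q
   to be square, that is n + r = m; r is the number of discarded zero rows. *)
Definition Qless_QR m n (X : 'M[R]_(m, n)) (U : 'M[R]_n) :=
  is_trig_mx U^T /\
  exists r (Q : 'M[R]_(n + r, m)),
    [/\ Q^T *m Q = 1%:M, Q *m Q^T = 1%:M & Q *m X = col_mx U 0].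

End factorizations.

(* Main.v *)
(* The symmetric positive definite precision matrix A = P^-1 is reduced to
   L^T A L = 2 I by completing the square one coordinate at a time; by
   Tonelli and the one-dimensional affine change of variables, Lebesgue measure
   is carried to a multiple of itself at each step. Hence W = L^-1 (X - mu) has
   a density proportional to prod_i exp(- z_i^2), whose constant is fixed by
   the total mass. Reflecting one coordinate kills the first and mixed moments,
   and E[W_i^2] = 1/2, so that E[X X^T] = L L^T / 2 + mu mu^T = P + mu mu^T.
   The factorization is then a block computation with
   M11^T M11 = P + mu mu^T, in which lambda^T lambda = mu^T (P + mu mu^T)^-1 mu
   is at most 1. *)
Require Import Defs.
From HB Require Import structures.
From mathcomp Require Import all_boot all_order all_algebra.
From mathcomp Require Import all_classical all_reals all_analysis.
From mathcomp Require Import measurable_realfun ring lra.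

Import Order.TTheory GRing.Theory Num.Theory.
Import numFieldNormedType.Exports.

Local Open Scope classical_set_scope.
Local Open Scope ring_scope.

Set Implicit Arguments.
Unset Strict Implicit.

(** * Positive definite matrices and Schur complements *)

Lemma posdefmx_unit (R : realType) n (P : 'M[R]_n) : posdefmx P -> P \in unitmx.
Proof.
move=> [_ P0]; rewrite -unitmx_tr -row_free_unit; apply/row_freeP.
suff : kermx P^T = 0.
  move=> /eqP; rewrite kermx_eq0 => /row_freeP //.
apply/eqP; apply: contraT => /rowV0Pn[v /sub_kermxP vP v0].
have vT0 : v^T != 0 by rewrite -trmx0 (inj_eq trmx_inj).
have := P0 _ vT0; rewrite trmxK -mulmxA.
by rewrite -[P *m v^T]trmxK trmx_mul trmxK vP trmx0 mulmx0 mxE ltxx.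
Qed.

Lemma posdefmx_inv (R : realType) n (P : 'M[R]_n) :
  posdefmx P -> posdefmx (invmx P).
Proof.
move=> Ppd; have Pu := posdefmx_unit Ppd.
case: Ppd => PT P0; split; first by rewrite trmx_inv PT.
move=> v v0; have : invmx P *m v != 0.
  by apply: contra_neq v0 => /(congr1 (mulmx P)); rewrite mulKVmx// mulmx0.
by move=> /P0; rewrite trmx_mul trmx_inv PT -!mulmxA mulKVmx.
Qed.

(** Completing the square in the first coordinate: the Schur complement is what remains of the
    quadratic form once that coordinate takes its minimising value. *)
Lemma posdefmx_block (R : realType) n (a : R) (b : 'cV[R]_n) (D : 'M[R]_n) :
  posdefmx (block_mx (a%:M : 'M[R]_1) b^T b D) ->
  0 < a /\ posdefmx (D - a^-1 *: (b *m b^T)).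
Proof.
move=> [AT A0].
have qE (x : R) (v : 'cV[R]_n) :
    (col_mx x%:M v)^T *m block_mx (a%:M : 'M[R]_1) b^T b D *m col_mx x%:M v =
    (x * a * x)%:M + x *: (b^T *m v) + x *: (v^T *m b) +
    v^T *m D *m v :> 'M[R]_1.
  rewrite tr_col_mx tr_scalar_mx mul_row_block mul_row_col !mul_scalar_mx.
  rewrite !mulmxDl !scale_scalar_mx -!scalar_mxM !mul_mx_scalar.
  by rewrite -scalemxAl -!addrA; congr (_ + _); rewrite addrCA.
have a0 : 0 < a.
  have := A0 (col_mx 1%:M 0); rewrite qE trmx0 !mulmx0 mul0mx !scaler0 !addr0.
  rewrite mul1r mulr1 mxE eqxx mulr1n; apply.
  by apply/eqP => /(congr1 usubmx); rewrite col_mxKu linear0 => /eqP;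
    rewrite oner_eq0.
split=> //; split.
  rewrite linearB linearZ/= trmx_mul trmxK; congr (_ - _).
  by move: AT; rewrite tr_block_mx => /eq_block_mx[].
move=> v v0.
have [g bvE] : exists g : R, b^T *m v = g%:M.
  by exists ((b^T *m v) ord0 ord0); exact: mx11_scalar.
have [q vDvE] : exists q : R, v^T *m D *m v = q%:M.
  by exists ((v^T *m D *m v) ord0 ord0); exact: mx11_scalar.
have vbE : v^T *m b = g%:M.
  by rewrite -[LHS]trmxK trmx_mul trmxK bvE tr_scalar_mx.
(* For fixed [v] the form a x^2 + 2 g x + q is minimal at x = -g/a, where it equals q - g^2/a. *)
have /A0 : col_mx (- (a^-1 * g))%:M v != 0.
  by apply: contra_neq v0 => /(congr1 dsubmx); rewrite col_mxKd linear0.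
rewrite qE mulmxBr mulmxBl -scalemxAr -scalemxAl mulmxA -(mulmxA _ b^T).
rewrite vbE bvE vDvE -scalar_mxM !mxE eqxx !mulr1n.
congr (0 < _); field; exact: lt0r_neq0.
Qed.

(** One step of block elimination: the top right block of [L1] is the one that cancels the
    off-diagonal block, and [r] rescales the pivot [a] to 2. *)
Lemma schur_congruence (R : realType) n (a r : R) (b : 'cV[R]_n)
    (D L : 'M[R]_n) :
  a != 0 -> a * r ^+ 2 = 2 ->
  L^T *m (D - a^-1 *: (b *m b^T)) *m L = 2%:M ->
  let L1 := block_mx (r%:M : 'M[R]_1) (- (a^-1 *: (b^T *m L))) 0 L in
  L1^T *m block_mx (a%:M : 'M[R]_1) b^T b D *m L1 = 2%:M.
Proof.
move=> a0 ar LL L1; rewrite /L1 -mulmxA mulmx_block !mulmx0 !addr0.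
rewrite [a%:M *m - _]mul_scalar_mx scalerN scalerA divff// scale1r addNr mulmxN.
have -> : - (b *m (a^-1 *: (b^T *m L))) + D *m L =
    (D - a^-1 *: (b *m b^T)) *m L.
  by rewrite -scalemxAr mulmxBl -scalemxAl mulmxA addrC.
rewrite tr_block_mx trmx0 mulmx_block !mul0mx !mulmx0 !addr0 add0r.
rewrite [L^T *m (_ *m L)]mulmxA LL.
rewrite tr_scalar_mx.
have -> : (- (a^-1 *: (b^T *m L)))^T *m (a%:M *m r%:M) + L^T *m (b *m r%:M) = 0.
  rewrite linearN linearZ/= trmx_mul trmxK mulNmx -scalar_mxM !mul_mx_scalar.
  by rewrite -scalemxAr scalerA mulrAC mulfV// mul1r addNr.
by rewrite -!scalar_mxM mulrCA -expr2 ar -scalar_mx_block.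
Qed.

(** * Expectations of random matrices *)

Lemma expectation_mxE d (T : measurableType d) (R : realType)
    (Pr : probability T R) m n (Y : T -> 'M[R]_(m, n)) (E : 'M[R]_(m, n)) :
  (forall i j, \int[Pr]_w (Y w i j)%:E = (E i j)%:E)%E ->
  expectation_mx Pr Y = E.
Proof.
by move=> YE; apply/matrixP => i j; rewrite mxE unlock YE.
Qed.

(** [expectation_mx] goes through [fine], which sends infinite values to 0; integrability ensures
    that nothing is lost. *)
Lemma integral_expectation_mx d (T : measurableType d) (R : realType)
    (Pr : probability T R) m n (Y : T -> 'M[R]_(m, n)) i j :
  integrable_mx Pr Y ->
  (\int[Pr]_w (Y w i j)%:E = (expectation_mx Pr Y i j)%:E)%E.
Proof.
by move=> iY; rewrite mxE unlock fineK//; exact: integrable_fin_num.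
Qed.

Lemma integrable_mxT d (T : measurableType d) (R : realType)
    (Pr : probability T R) m n (Y : T -> 'M[R]_(m, n)) :
  integrable_mx Pr Y -> integrable_mx Pr (fun w => (Y w)^T).
Proof. by move=> iY i j; under eq_fun do rewrite mxE; exact: iY. Qed.

Lemma expectation_mxT d (T : measurableType d) (R : realType)
    (Pr : probability T R) m n (Y : T -> 'M[R]_(m, n)) :
  expectation_mx Pr (fun w => (Y w)^T) = (expectation_mx Pr Y)^T.
Proof.
apply/matrixP => i j; rewrite !mxE; congr (fine 'E_Pr[_]).
by apply/funext => w; rewrite mxE.
Qed.

Lemma integrable_expectation_mulmx d (T : measurableType d) (R : realType)
    (Pr : probability T R) p m n (B : 'M[R]_(p, m)) (Y : T -> 'M[R]_(m, n)) :
  integrable_mx Pr Y ->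
  integrable_mx Pr (fun w => B *m Y w) /\
  expectation_mx Pr (fun w => B *m Y w) = B *m expectation_mx Pr Y.
Proof.
move=> iY.
have BYE i j w : ((B *m Y w) i j)%:E = (\sum_k (B i k)%:E * (Y w k j)%:E)%E.
  by rewrite mxE -sumEFin.
split=> [i j|].
  under eq_fun do rewrite BYE.
  by apply: integrable_sum => // k _; apply: integrableZl => //; exact: iY.
apply: expectation_mxE => i j; under eq_integral do rewrite BYE.
rewrite integral_sum//; last first.
  by move=> k; apply: integrableZl => //; exact: iY.
rewrite mxE -sumEFin; apply: eq_bigr => k _.
by rewrite integralZl// integral_expectation_mx.
Qed.

Lemma integrable_expectation_congruence d (T : measurableType d) (R : realType)
    (Pr : probability T R) m n (B : 'M[R]_(m, n)) (Y : T -> 'M[R]_n) :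
  integrable_mx Pr Y ->
  integrable_mx Pr (fun w => B *m Y w *m B^T) /\
  expectation_mx Pr (fun w => B *m Y w *m B^T) =
    B *m expectation_mx Pr Y *m B^T.
Proof.
move=> /(integrable_expectation_mulmx B)[iBY EBY].
(* Right multiplication is reduced to left multiplication by transposing twice. *)
have -> : (fun w => B *m Y w *m B^T) = (fun w => (B *m (B *m Y w)^T)^T).
  by apply/funext => w; rewrite trmx_mul trmxK.
have [iBYB EBYB] := integrable_expectation_mulmx B (integrable_mxT iBY).
split; first exact: integrable_mxT.
by rewrite expectation_mxT EBYB expectation_mxT EBY trmx_mul trmxK.
Qed.

(** * Gram matrices and rank-one updates *)

(** An orthogonal [Q] cancels in the Gram matrix of [Q *m X], and the zero rows contribute nothing
    to it. *)
Lemma Qless_QR_gram (R : realType) m n (X : 'M[R]_(m, n)) (U : 'M[R]_n) :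
  Qless_QR X U -> U^T *m U = X^T *m X.
Proof.
move=> [_ [r [Q [QTQ _ QX]]]].
have : (Q *m X)^T *m (Q *m X) = (col_mx U 0)^T *m col_mx U (0 : 'M[R]_(r, n)).
  by rewrite QX.
rewrite trmx_mul mulmxA -(mulmxA X^T) QTQ mulmx1 => ->.
by rewrite tr_col_mx mul_row_col mulmx0 addr0.
Qed.

Lemma augmented_gram (R : realType) p n (F : 'M[R]_(p, n)) (mu : 'cV[R]_n) :
  (col_mx F mu^T)^T *m col_mx F mu^T = F^T *m F + mu *m mu^T.
Proof. by rewrite tr_col_mx mul_row_col trmxK. Qed.

Lemma posdefmx_rank1 (R : realType) n (P : 'M[R]_n) (mu : 'cV[R]_n) :
  posdefmx P -> posdefmx (P + mu *m mu^T).
Proof.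
move=> [PT P0]; split; first by rewrite linearD/= trmx_mul trmxK PT.
move=> v v0; rewrite mulmxDr mulmxDl mxE ltr_pwDl ?P0//.
(* The added term is the square of the number [mu^T *m v]. *)
rewrite mulmxA -mulmxA (_ : v^T *m mu = (mu^T *m v)^T); last first.
  by rewrite trmx_mul trmxK.
by rewrite [mu^T *m v]mx11_scalar tr_scalar_mx -scalar_mxM mxE eqxx mulr1n
  sqr_ge0.
Qed.

Lemma posdefmx_ge0 (R : realType) n (P : 'M[R]_n) (v : 'cV[R]_n) :
  posdefmx P -> 0 <= (v^T *m P *m v) ord0 ord0.
Proof.
move=> [_ P0]; have [->|/P0/ltW//] := eqVneq v 0.
by rewrite mulmx0 mxE.
Qed.

(* With x = K^-1 mu, the number c = mu^T x satisfies
   c = x^T K x = x^T P x + c^2 >= c^2. *)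
Lemma rank1_update_le1 (R : realType) n (P : 'M[R]_n) (mu : 'cV[R]_n) :
  posdefmx P -> (mu^T *m invmx (P + mu *m mu^T) *m mu) ord0 ord0 <= 1.
Proof.
move=> Ppd; have Kpd := posdefmx_rank1 mu Ppd.
have Ku := posdefmx_unit Kpd; have [KT _] := Kpd.
set K := P + mu *m mu^T in Kpd Ku KT *; pose x := invmx K *m mu.
have xT : x^T = mu^T *m invmx K by rewrite trmx_mul trmx_inv KT.
have -> : mu^T *m invmx K *m mu = x^T *m mu by rewrite xT.
have [c xmu] : exists c : R, x^T *m mu = c%:M.
  by exists ((x^T *m mu) ord0 ord0); exact: mx11_scalar.
have mux : mu^T *m x = c%:M.
  by rewrite -[LHS]trmxK trmx_mul trmxK xmu tr_scalar_mx.
have : x^T *m K *m x = c%:M by rewrite xT mulmxKV// mux.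
rewrite /K mulmxDr mulmxDl [x^T *m (mu *m _)]mulmxA -(mulmxA (x^T *m mu)).
rewrite xmu mux -scalar_mxM.
have := posdefmx_ge0 x Ppd; rewrite [x^T *m P *m x]mx11_scalar.
move: ((x^T *m P *m x) _ _) => q + /matrixP/(_ ord0 ord0).
rewrite !mxE eqxx !mulr1n => q0 qc; nra.
Qed.

(** * Changes of variables for Lebesgue measure *)

(** Multiplied by [r], the pushforward of Lebesgue measure under the affine map gives each half-open
    interval its length, so uniqueness identifies it with Lebesgue measure. *)
Lemma ge0_integral_affine (R : realType) (r s : R) (f : R -> \bar R) :
  0 < r -> measurable_fun [set: R] f -> (forall x, 0 <= f x)%E ->
  (\int[lebesgue_measure]_x f x =
   r%:E * \int[lebesgue_measure]_x f (r * x + s)%R)%E.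
Proof.
move=> r0 mf f0.
pose phi : measurableTypeR R -> measurableTypeR R := fun x => r * x + s.
have mphi : measurable_fun [set: measurableTypeR R] phi.
  by apply: measurable_funD => //; apply: measurable_funM.
pose nu := mscale (NngNum (ltW r0))
  (pushforward (@lebesgue_measure R) phi).
have nuE A : measurable A -> lebesgue_measure A = nu mphi A.
  apply: lebesgue_measure_unique => _ [[a b]] _ <-.
  rewrite -[RHS]/(r%:E * lebesgue_measure (phi @^-1` `]a, b]%classic))%E.
  have -> : phi @^-1` `]a, b]%classic = `](a - s) / r, (b - s) / r]%classic.
    apply/seteqP; split=> x /=; rewrite /phi !in_itv /=;
    by rewrite ltr_pdivrMr// ler_pdivlMr// (mulrC x) ltrBlDr lerBrDr.
  rewrite !lebesgue_measure_itv/= !lte_fin ltr_pM2r ?invr_gt0// ltrD2r.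
  case: ifP => _; last by rewrite mule0.
  by rewrite -!EFinB -EFinM; congr EFin; field; rewrite gt_eqF.
transitivity (\int[nu mphi]_x f x)%E.
  by apply: eq_measure_integral => A mA _; exact: nuE.
rewrite /nu ge0_integral_mscale//= ge0_integral_pushforward//.
Qed.

Lemma ge0_integral_opp (R : realType) (f : R -> \bar R) :
  measurable_fun [set: R] f -> (forall x, 0 <= f x)%E ->
  (\int[lebesgue_measure]_x f x = \int[lebesgue_measure]_x f (- x)%R)%E.
Proof.
move=> mf f0.
transitivity (\int[pushforward (@lebesgue_measure R)
    (-%R : _ -> measurableTypeR R)]_x f x)%E.
  by apply: eq_measure_integral => A mA _; exact/esym/lebesgue_measureN.
rewrite ge0_integral_pushforward//.
Qed.

(** [lebesgue_cV n.+1] is a pushforward of a product by construction, so this is Tonelli. The first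
    coordinate is innermost, which leaves the outer integral to induction on the dimension. *)
Lemma ge0_integral_lebesgue_cVS (R : realType) n (F : 'cV[R]_n.+1 -> \bar R) :
  measurable_fun [set: 'cV[R]_n.+1] F -> (forall x, 0 <= F x)%E ->
  (\int[lebesgue_cV n.+1]_x F x =
   \int[lebesgue_cV n]_v \int[lebesgue_measure]_t F (cons_cV (t, v)))%E.
Proof.
move=> mF F0.
transitivity (\int[pushforward (lebesgue_measure \x lebesgue_cV n)%E
  (@cons_cV R n)]_x F x)%E; first by [].
rewrite ge0_integral_pushforward//=; last exact: measurable_cons_cV.
apply: (fubini_tonelli2 (m1 := @lebesgue_measure R) (m2 := lebesgue_cV n)
  (F \o @cons_cV R n)) => //.
  by apply: measurableT_comp => //; exact: measurable_cons_cV.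
by move=> x; exact: F0.
Qed.

Lemma measurable_affine_mx (R : realType) m n (a : 'cV[R]_m)
    (L : 'M[R]_(m, n)) :
  measurable_fun [set: 'cV[R]_n] (fun z => a + L *m z).
Proof.
apply/measurable_fun_matrixP => i j.
under eq_fun do rewrite !mxE.
apply: measurable_funD => //.
apply: measurable_sum => k; apply: measurable_funM => //.
exact: measurable_entry.
Qed.

Lemma measurable_int_cons (R : realType) n (F : 'cV[R]_n.+1 -> \bar R) :
  measurable_fun [set: 'cV[R]_n.+1] F -> (forall x, 0 <= F x)%E ->
  measurable_fun [set: 'cV[R]_n]
    (fun v => \int[lebesgue_measure]_t F (cons_cV (t, v)))%E.
Proof.
move=> mF F0.
apply: (measurable_fun_fubini_tonelli_G (m1 := @lebesgue_measure R)
  (F \o @cons_cV R n)).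
  by apply: measurableT_comp => //; exact: measurable_cons_cV.
by move=> x; exact: F0.
Qed.

(** Block triangularity separates the variables: once [z] is frozen, only the first coordinate
    depends on [t], so the one-dimensional change of variables applies. *)
Lemma affine_map_block (R : realType) n (m0 r t : R) (w : 'rV[R]_n)
    (mu z : 'cV[R]_n) (L : 'M[R]_n) :
  col_mx (m0%:M : 'M[R]_1) mu +
    block_mx (r%:M : 'M[R]_1) w 0 L *m col_mx (t%:M : 'M[R]_1) z =
  col_mx ((r * t + (m0 + (w *m z) ord0 ord0))%:M : 'M[R]_1) (mu + L *m z).
Proof.
rewrite mul_block_col mul0mx add0r add_col_mx.
rewrite -scalar_mxM [w *m z]mx11_scalar -!raddfD/= -[in RHS]mx11_scalar.
by rewrite addrCA.
Qed.

(** The same [L] must both reduce [A] and transport the measure, so the two claims share one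
    induction, whose hypothesis is applied to the Schur complement. The constant [c] is built as the
    product of the slopes [r], without computing a determinant. *)
Lemma ge0_integral_posdef (R : realType) n (A : 'M[R]_n) (mu : 'cV[R]_n) :
  posdefmx A -> exists (L : 'M[R]_n) (c : R),
  [/\ 0 <= c, L^T *m A *m L = 2%:M &
    forall F : 'cV[R]_n -> \bar R,
      measurable_fun [set: 'cV[R]_n] F -> (forall x, 0 <= F x)%E ->
      (\int[lebesgue_cV n]_x F x =
       c%:E * \int[lebesgue_cV n]_z F (mu + L *m z)%R)%E].
Proof.
elim: n A mu => [|n IHn] A mu Apd.
  exists 0, 1; split => //; first by rewrite !flatmx0.
  move=> F mF F0; rewrite mul1e; apply: eq_integral => x _.
  by rewrite [in RHS]flatmx0 [x in LHS]flatmx0.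
pose a := ulsubmx (A : 'M[R]_(1 + n)) ord0 ord0.
pose b := dlsubmx (A : 'M[R]_(1 + n)).
pose D := drsubmx (A : 'M[R]_(1 + n)).
pose m0 := usubmx (mu : 'cV[R]_(1 + n)) ord0 ord0.
pose mu' := dsubmx (mu : 'cV[R]_(1 + n)).
have AE : A = block_mx (a%:M : 'M[R]_1) b^T b D :> 'M[R]_(1 + n).
  apply: etrans (esym (submxK (A : 'M[R]_(1 + n)))) _.
  congr block_mx; first exact: mx11_scalar.
  by rewrite /b trmx_dlsub Apd.1.
have muE : mu = col_mx (m0%:M : 'M[R]_1) mu' :> 'cV[R]_(1 + n).
  apply: etrans (esym (vsubmxK (mu : 'cV[R]_(1 + n)))) _.
  by congr col_mx; exact: mx11_scalar.
have [a0 Spd] : 0 < a /\ posdefmx (D - a^-1 *: (b *m b^T)).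
  by apply: posdefmx_block; rewrite -AE.
have [L [c [c0 LL Lc]]] := IHn _ mu' Spd.
pose r := Num.sqrt (2 / a).
have r0 : 0 < r by rewrite sqrtr_gt0 divr_gt0.
have ar2 : a * r ^+ 2 = 2.
  by rewrite sqr_sqrtr ?divr_ge0 ?ltW// mulrC divfK// gt_eqF.
pose L1 : 'M[R]_(1 + n) :=
  block_mx (r%:M : 'M[R]_1) (- (a^-1 *: (b^T *m L))) 0 L.
exists L1, (c * r); split.
- by rewrite mulr_ge0// ltW.
- by rewrite AE; apply: schur_congruence => //; rewrite gt_eqF.
move=> F mF F0.
(* Offset of the first coordinate once the remaining coordinates [z] are frozen. *)
pose s (z : 'cV[R]_n) := m0 + (- (a^-1 *: (b^T *m L)) *m z) ord0 ord0.
have L1E t z : mu + L1 *m cons_cV (t, z) = cons_cV (r * t + s z, mu' + L *m z).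
  rewrite muE; exact: affine_map_block.
(* The induction hypothesis transforms the outer integral over the last [n] coordinates; the affine
   change of variables then treats the inner one. *)
rewrite ge0_integral_lebesgue_cVS// (Lc _ (measurable_int_cons mF F0))//;
  last by move=> v; exact: integral_ge0.
rewrite EFinM -muleA; congr (_ * _)%E.
have mG : measurable_fun [set: 'cV[R]_n.+1] (fun z => F (mu + L1 *m z)).
  by apply: measurableT_comp mF _; exact: measurable_affine_mx.
rewrite ge0_integral_lebesgue_cVS//.
rewrite -ge0_integralZl_EFin//; last 3 first.
- by move=> z _; exact: integral_ge0.
- exact: (measurable_int_cons mG).
- exact: ltW.
apply: eq_integral => z _; rewrite (ge0_integral_affine (s z) r0)//.
  by congr (_ * _)%E; apply: eq_integral => t _; rewrite L1E.
apply: measurableT_comp mF _.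
apply: measurableT_comp (@measurable_cons_cV R n) _.
exact: pair2_measurable.
Qed.

(** * Product integrands and reflections of a coordinate *)

Lemma measurable_prod_entries (R : realType) n (f : 'I_n -> R -> R) :
  (forall i, measurable_fun [set: R] (f i)) ->
  measurable_fun [set: 'cV[R]_n] (fun z => \prod_i f i (z i ord0)).
Proof.
move=> mf; apply: measurable_prod => i _.
by apply: measurableT_comp (mf i) _; exact: measurable_entry.
Qed.

Lemma ge0_integral_prod (R : realType) n (f : 'I_n -> R -> R) :
  (forall i, measurable_fun [set: R] (f i)) -> (forall i t, 0 <= f i t) ->
  (\int[lebesgue_cV n]_z (\prod_i f i (z i ord0))%:E =
   \prod_i \int[lebesgue_measure]_t (f i t)%:E)%E.
Proof.
elim: n f => [|n IHn] f mf f0.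
  rewrite big_ord0; under eq_integral do rewrite big_ord0.
  by rewrite integral_cst// mul1e /= diracT.
rewrite ge0_integral_lebesgue_cVS; last 2 first.
- by apply/measurable_EFinP; exact: measurable_prod_entries.
- by move=> z; rewrite lee_fin prodr_ge0.
pose g (i : 'I_n) := f (lift ord0 i).
have mf0 : measurable_fun [set: R] (fun t => (f ord0 t)%:E).
  exact/measurable_EFinP.
transitivity (\int[lebesgue_cV n]_v
  ((\int[lebesgue_measure]_t (f ord0 t)%:E) * (\prod_i g i (v i ord0))%:E))%E.
  apply: eq_integral => v _; rewrite -ge0_integralZr//=; last 2 first.
  - by move=> t _; rewrite lee_fin.
  - by rewrite lee_fin prodr_ge0// => i _; exact: f0.
  apply: eq_integral => t _; rewrite -EFinM big_ord_recl; congr (_ * _)%:E.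
    by rewrite cons_cVE unlift_none.
  by apply: eq_bigr => i _; rewrite cons_cVE liftK.
rewrite ge0_integralZl//; last 3 first.
- apply/measurable_EFinP; apply: measurable_prod_entries => i.
  exact: (mf (lift ord0 i)).
- by move=> z _; rewrite lee_fin prodr_ge0// => i _; exact: f0.
- by apply: integral_ge0 => t _; rewrite lee_fin.
rewrite big_ord_recl IHn// => i; first [exact: (mf (lift ord0 i))|exact: f0].
Qed.

Definition reflect_cV (R : realType) n (i : 'I_n) (z : 'cV[R]_n) : 'cV[R]_n :=
  \col_j (if j == i then - z j ord0 else z j ord0).

Lemma measurable_reflect_cV (R : realType) n (i : 'I_n) :
  measurable_fun [set: 'cV[R]_n] (reflect_cV i).
Proof.
apply/measurable_fun_matrixP => j k; under eq_fun do rewrite mxE.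
case: eqP => _; last exact: measurable_entry.
by apply: measurableT_comp => //; exact: measurable_entry.
Qed.

(** Induction on the dimension: a coordinate in the tail is handled in the outer integral, the first
    one by the symmetry of Lebesgue measure on the line. *)
Lemma ge0_integral_reflect (R : realType) n (i : 'I_n)
    (F : 'cV[R]_n -> \bar R) :
  measurable_fun [set: 'cV[R]_n] F -> (forall x, 0 <= F x)%E ->
  (\int[lebesgue_cV n]_z F z = \int[lebesgue_cV n]_z F (reflect_cV i z))%E.
Proof.
elim: n i F => [[]//|n IHn] i F mF F0.
have mFr : measurable_fun [set: 'cV[R]_n.+1] (fun z => F (reflect_cV i z)).
  by apply: measurableT_comp mF _; exact: measurable_reflect_cV.
rewrite !ge0_integral_lebesgue_cVS//.
case: (unliftP ord0 i) mFr => [j ->|->] mFr.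
  rewrite (IHn j); last 2 first.
  - exact: measurable_int_cons.
  - by move=> v; exact: integral_ge0.
  apply: eq_integral => v _; apply: eq_integral => t _; congr F.
  apply/colP => k; rewrite [RHS]mxE !cons_cVE.
  case: (unliftP ord0 k) => [l ->|->]; last by rewrite (negbTE (neq_lift _ _)).
  by rewrite (inj_eq lift_inj) mxE.
apply: eq_integral => v _; rewrite ge0_integral_opp//.
  apply: eq_integral => t _; congr F.
  apply/colP => k; rewrite [RHS]mxE !cons_cVE.
  case: (unliftP ord0 k) => [l ->|->]; last by rewrite eqxx.
  by rewrite eq_sym (negbTE (neq_lift _ _)).
apply: measurableT_comp mF _.
apply: measurableT_comp (@measurable_cons_cV R n) _.
exact: pair2_measurable.
Qed.

(** * One-dimensional Gaussian integrals *)

(** Squeezed between 0 and 1/x, since exp(x^2) >= 1 + x^2 gives x^2 exp(-x^2) <= 1. This is the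
    boundary term at infinity of an integration by parts. *)
Lemma cvg_id_gauss_fun (R : realType) :
  (x : R) * gauss_fun x @[x --> +oo] --> (0 : R).
Proof.
apply: (@squeeze_cvgr _ _ _ _ (cst 0) (fun x : R => x^-1)).
- near=> x; have x0 : 0 < x by near: x; exact: nbhs_pinfty_gt.
  apply/andP; split; first by rewrite mulr_ge0 ?gauss_fun_ge0 ?ltW.
  rewrite -[leRHS]mulr1.
  rewrite -ler_pdivrMl ?invr_gt0// invrK mulrA -expr2 /gauss_fun expRN.
  rewrite ler_pdivrMr ?expR_gt0// mul1r.
  by rewrite (le_trans _ (expR_ge1Dx _))// lerDr.
- exact: cvg_cst.
- apply/(@cvgrVy _ _ _ _ (fun x : R => x^-1)).
    by near=> x; rewrite invr_gt0; near: x; exact: nbhs_pinfty_gt.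
  rewrite (_ : unstable.inv_fun _ = id)//; apply/funext => x.
  by rewrite /unstable.inv_fun /= invrK.
Unshelve. all: end_near. Qed.

Import gauss_integral_proof.

Lemma cvg_integral0_gauss (R : realType) :
  integral0_gauss x @[x --> +oo] --> (Num.sqrt pi / 2 : R).
Proof.
have -> : (Num.sqrt pi / 2 : R) = Num.sqrt (pi / 4).
  rewrite sqrtrM ?pi_ge0// sqrtrV// (_ : 4 = 2 ^+ 2); last by rewrite -natrX.
  by rewrite sqrtr_sqr ger0_norm.
have -> : @integral0_gauss R = (fun x => Num.sqrt (integral0_gauss x ^+ 2)).
  by apply/funext => x; rewrite sqrtr_sqr ger0_norm// integral0_gauss_ge0.
apply: continuous_cvg; first exact: sqrt_continuous.
exact: cvg_integral0_gauss_sqr.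
Qed.

Lemma integral_sqr_gauss (R : realType) :
  (\int[lebesgue_measure]_x (x ^+ 2 * gauss_fun x)%:E =
   (Num.sqrt (pi : R) / 2)%:E)%E.
Proof.
have cf : continuous (fun x : R => x ^+ 2 * gauss_fun x).
  move=> x; apply: cvgM; first exact: exprn_continuous.
  exact: continuous_gauss_fun.
have cxg : continuous (fun x : R => x * gauss_fun x).
  by move=> x; apply: cvgM; [exact: cvg_id|exact: continuous_gauss_fun].
have dg (x : R) : is_derive x 1 gauss_fun (- (2 * x) * gauss_fun x).
  rewrite /gauss_fun; apply: is_derive_eq.
  by rewrite /GRing.scale/= mulr1; ring.
have dI (x : R) : 0 < x -> is_derive x 1 (@integral0_gauss R) (gauss_fun x).
  move=> x0.
  (* [x + 1] is an arbitrary endpoint beyond [x], chosen so that [x] is an interior point. *)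
  have [||||dx xE] := @continuous_FTC1 R gauss_fun (BLeft 0) x (x + 1).
  - by rewrite ltrDl.
  - apply: continuous_compact_integrable; first exact: segment_compact.
    by apply: continuous_subspaceT; exact: continuous_gauss_fun.
  - by rewrite /= lte_fin.
  - exact: continuous_gauss_fun.
  by apply: DeriveDef => //; rewrite -derive1E xE.
rewrite ge0_symfun_integralT//=; last 2 first.
- by move=> x; rewrite mulr_ge0 ?sqr_ge0// gauss_fun_ge0.
- by move=> x /=; rewrite /gauss_fun !sqrrN.
rewrite -set_itvcy -ge0_integralZl_EFin//=; last 2 first.
- by move=> x _; rewrite lee_fin mulr_ge0 ?sqr_ge0// gauss_fun_ge0.
- apply/measurable_EFinP; apply: measurable_funTS.
  exact: continuous_measurable_fun.
(* Integration by parts: in the derivative, the integrand [gauss_fun x] cancels against the product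
   rule and leaves 2 x^2 exp(-x^2). [F] vanishes at 0 and tends to sqrt(pi)/2; the factor 2 comes
   from the evenness of the integrand. *)
pose F (x : R) := integral0_gauss x - x * gauss_fun x.
have dF (x : R) : 0 < x -> is_derive x 1 F (2 * (x ^+ 2 * gauss_fun x)).
  move=> x0; have := dI x x0; have := dg x; rewrite /F => dgx dIx.
  by apply: is_derive_eq; rewrite /GRing.scale/= mulr1; ring.
under eq_integral do rewrite -EFinM.
rewrite (@ge0_continuous_FTC2y R _ F 0 (Num.sqrt pi / 2)).
- rewrite /F /integral0_gauss set_itv1 Rintegral_set1 mul0r subrr.
  by rewrite -EFinB subr0.
- by move=> x _; rewrite mulr_ge0// mulr_ge0 ?sqr_ge0 ?gauss_fun_ge0.
- apply: continuous_subspaceT => x.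
  by apply: cvgM; [exact: cvg_cst|exact: cf].
- rewrite -[X in _ --> X]subr0.
  by apply: cvgB; [exact: cvg_integral0_gauss|exact: cvg_id_gauss_fun].
- by move=> x /dF[].
(* At 0 only continuity from the right is required; it comes from the continuity of an integral in
   its upper bound, here on [0, 1]. *)
- have int01 : lebesgue_measure.-integrable `[0, 1] (EFin \o @gauss_fun R).
    apply: continuous_compact_integrable; first exact: segment_compact.
    by apply: continuous_subspaceT; exact: continuous_gauss_fun.
  have /continuous_within_itvP[//|_ + _] :=
    @parameterized_integral_continuous R 0 1 _ ler01 int01.
  move=> cI; apply: cvgB; first exact: cI.
  by apply: cvg_at_right_filter; exact: cxg.
- by move=> x; rewrite in_itv/= andbT => /dF ?; rewrite derive1E derive_val.
Qed.

(** * Integration against a density *)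

Section density.
Local Open Scope ereal_scope.
Import HBNNSimple.

(** The hypothesis on [nu] is the case of indicators; linearity extends it to simple functions, and
    monotone convergence to nonnegative measurable ones. *)
Lemma ge0_integral_density d (T : measurableType d) (R : realType)
    (mu nu : {measure set T -> \bar R}) (g : T -> R) (f : T -> \bar R) :
  measurable_fun [set: T] g -> (forall x, 0 <= g x)%R ->
  (forall A, measurable A -> nu A = \int[mu]_(x in A) (g x)%:E) ->
  measurable_fun [set: T] f -> (forall x, 0 <= f x) ->
  \int[nu]_x f x = \int[mu]_x (f x * (g x)%:E).
Proof.
move=> mg g0 nuE mf f0.
have mEg : measurable_fun [set: T] (fun x => (g x)%:E).
  exact/measurable_EFinP.
have nnsfunE (h : {nnsfun T >-> R}) :
    \int[nu]_x (h x)%:E = \int[mu]_x ((h x)%:E * (g x)%:E).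
  rewrite integralT_nnsfun sintegralE.
  under [RHS]eq_integral => x _.
    rewrite fimfunE -fsumEFin//= ge0_mule_fsuml; last first.
      by move=> r; exact: nnfun_muleindic_ge0.
    over.
  have mh r : measurable (h @^-1` [set r]) by [].
  rewrite ge0_integral_fsum//; last 2 first.
  - move=> r; apply: emeasurable_funM => //.
    by apply/measurable_EFinP; apply: measurable_funM.
  - by move=> r x _; rewrite mule_ge0// ?lee_fin//; exact: nnfun_muleindic_ge0.
  apply: eq_fsbigr => r /[!inE] -[x _ <-].
  under eq_integral do rewrite EFinM -muleA.
  rewrite ge0_integralZl_EFin//; last 2 first.
  - by move=> y _; rewrite mule_ge0// lee_fin.
  - by apply: emeasurable_funM => //; exact/measurable_EFinP.
  rewrite nuE// integral_mkcond; congr (_ * _); apply: eq_integral => y _.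
  by rewrite epatch_indic /= muleC.
pose f_ := nnsfun_approx measurableT mf.
have f_f x : (f_ n x)%:E @[n --> \oo] --> f x by exact: cvg_nnsfun_approx.
transitivity (limn (fun n => \int[nu]_x (f_ n x)%:E)).
  rewrite -monotone_convergence//.
  - by apply: eq_integral => x _; apply/esym/cvg_lim => //; exact: f_f.
  - by move=> n; exact/measurable_EFinP.
  - by move=> n x _; rewrite lee_fin.
  - by move=> x _ m n mn; rewrite lee_fin; exact/lefP/nd_nnsfun_approx.
under eq_fun do rewrite nnsfunE.
rewrite -monotone_convergence//.
- apply: eq_integral => x _; apply/cvg_lim => //.
  by apply: cvgeZr => //; exact: f_f.
- by move=> n; apply: emeasurable_funM => //; exact/measurable_EFinP.
- by move=> n x _; rewrite mule_ge0// lee_fin.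
- move=> x _ m n mn; rewrite lee_wpmul2r ?lee_fin//.
  exact/lefP/nd_nnsfun_approx.
Qed.

End density.

(** * Standardisation of a Gaussian vector *)

Lemma measurable_gaussian_pdf (R : realType) n (mu : 'cV[R]_n) (P : 'M[R]_n) :
  measurable_fun [set: 'cV[R]_n] (gaussian_pdf mu P).
Proof.
have me i : measurable_fun [set: 'cV[R]_n] (fun x => (x - mu) i ord0).
  under eq_fun do rewrite mxE.
  by apply: measurable_funD => //; exact: measurable_entry.
apply: measurable_funM => //; apply: measurableT_comp => //.
apply: measurable_funM => //; apply: measurableT_comp => //.
under eq_fun do rewrite mxE.
apply: measurable_sum => i; apply: measurable_funM => //.
under eq_fun do rewrite mxE.
apply: measurable_sum => j; apply: measurable_funM => //.
under eq_fun do rewrite mxE; exact: me.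
Qed.

(** As [gauss_fun t] is exp(-t^2), this is the unnormalised density of the centred Gaussian with
    covariance I/2. *)
Definition std_weight (R : realType) n (z : 'cV[R]_n) : R :=
  \prod_i gauss_fun (z i ord0).

Lemma std_weight_ge0 (R : realType) n (z : 'cV[R]_n) : 0 <= std_weight z.
Proof. by rewrite prodr_ge0// => i _; exact: gauss_fun_ge0. Qed.

Lemma measurable_std_weight (R : realType) n :
  measurable_fun [set: 'cV[R]_n] (@std_weight R n).
Proof. exact: (measurable_prod_entries (fun=> measurable_gauss_fun)). Qed.

(** The 2 in the congruence cancels the 1/2 of the exponent, leaving exp(-z^T z), which factors over
    the coordinates. *)
Lemma gaussian_pdf_affine (R : realType) n (mu z : 'cV[R]_n) (P L : 'M[R]_n) :
  L^T *m invmx P *m L = 2%:M ->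
  gaussian_pdf mu P (mu + L *m z) =
  std_weight z / Num.sqrt ((pi *+ 2) ^+ n * \det P).
Proof.
move=> LL; rewrite /gaussian_pdf; congr (_ / _).
have -> : mu + L *m z - mu = L *m z by rewrite addrC addKr.
rewrite trmx_mul -!mulmxA (mulmxA (invmx P)) (mulmxA L^T) (mulmxA L^T) LL.
rewrite mul_scalar_mx -scalemxAr.
have -> : (2 *: (z^T *m z)) ord0 ord0 = 2 * (z^T *m z) ord0 ord0 by rewrite mxE.
rewrite -mulrN mulrAC mulfV// mul1r.
rewrite mxE /std_weight -sumrN expR_sum; apply: eq_bigr => i _.
by rewrite /gauss_fun mxE expr2.
Qed.

(* The constant c absorbs |det L| and the normalisation of the density: it is
   determined afterwards by the fact that Pr has mass 1. *)
Lemma gaussian_standardize d (T : measurableType d) (R : realType)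
    (Pr : probability T R) n (X : T -> 'cV[R]_n) (mu : 'cV[R]_n) (P : 'M[R]_n) :
  posdefmx P -> measurable_fun [set: T] X ->
  has_density Pr X (gaussian_pdf mu P) ->
  exists (L : 'M[R]_n) (c : R),
  [/\ 0 <= c, L \in unitmx, L *m L^T = 2 *: P &
    forall G : 'cV[R]_n -> \bar R,
      measurable_fun [set: 'cV[R]_n] G -> (forall x, 0 <= G x)%E ->
      (\int[Pr]_w G (invmx L *m (X w - mu))%R =
       c%:E * \int[lebesgue_cV n]_z (G z * (std_weight (z : 'cV[R]_n))%:E))%E].
Proof.
move=> Ppd mX dX.
have Pu := posdefmx_unit Ppd.
have [L [c [c0 LL Lc]]] := ge0_integral_posdef mu (posdefmx_inv Ppd).
(* A one-sided inverse of a square matrix is two-sided: this yields the invertibility of [L] and,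
   with the factors exchanged, [L *m L^T = 2 *: P]. *)
have LTu : (2^-1 *: L^T *m invmx P) *m L = 1%:M.
  by rewrite -!scalemxAl LL scale_scalar_mx mulVf.
have [_ Lu] := mulmx1_unit LTu.
have LLT : L *m L^T = 2 *: P.
  have := mulmx1C LTu => /(congr1 (mulmx^~ P)).
  rewrite mul1mx -mulmxA mulmxKV// -scalemxAr => <-.
  by rewrite scalerA mulfV// scale1r.
pose k := (Num.sqrt ((pi *+ 2) ^+ n * \det P))^-1.
have k0 : 0 <= k by rewrite invr_ge0 sqrtr_ge0.
exists L, (c * k); split => //; first exact: mulr_ge0.
move=> G mG G0.
have mst : measurable_fun [set: 'cV[R]_n] (fun x => invmx L *m (x - mu)).
  under eq_fun do rewrite mulmxBr addrC.
  exact: measurable_affine_mx.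
pose H x := G (invmx L *m (x - mu)).
have mH : measurable_fun [set: 'cV[R]_n] H by exact: measurableT_comp mG mst.
have pdf0 x : 0 <= gaussian_pdf mu P x.
  by rewrite mulr_ge0 ?expR_ge0// invr_ge0 sqrtr_ge0.
pose X' : {RV Pr >-> 'cV[R]_n} :=
  HB.pack X (isMeasurableFun.Build _ _ _ _ X mX).
transitivity (\int[distribution Pr X']_x H x)%E.
  by rewrite ge0_integral_distribution// => x; exact: G0.
rewrite (@ge0_integral_density _ _ _ (lebesgue_cV n) (distribution Pr X')
  (gaussian_pdf mu P))//; last 2 first.
- exact: measurable_gaussian_pdf.
- by move=> x; exact: G0.
have mpdf : measurable_fun [set: 'cV[R]_n] (fun x => (gaussian_pdf mu P x)%:E).
  by apply/measurable_EFinP; apply: measurable_gaussian_pdf.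
rewrite [LHS]Lc; last 2 first.
- exact: (emeasurable_funM mH mpdf).
- by move=> x; apply: mule_ge0; [exact: G0|rewrite lee_fin].
rewrite EFinM -muleA; congr (_ * _)%E.
rewrite -ge0_integralZl_EFin//; last 2 first.
- by move=> z _; rewrite mule_ge0// lee_fin std_weight_ge0.
- apply: (emeasurable_funM mG).
  by apply/measurable_EFinP; apply: measurable_std_weight.
apply: eq_integral => z _; rewrite gaussian_pdf_affine// /H.
have -> : mu + L *m z - mu = L *m z by rewrite addrC addKr.
by rewrite mulKmx// -/k EFinM muleA muleC.
Qed.

(** * Moments of the standardised vector *)

Lemma integral_std_weight (R : realType) n :
  (\int[lebesgue_cV n]_z (std_weight (z : 'cV[R]_n))%:E =
   (Num.sqrt pi ^+ n)%:E)%E.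
Proof.
rewrite (ge0_integral_prod (f := fun=> gauss_fun)); last 2 first.
- by move=> i; exact: measurable_gauss_fun.
- by move=> i t; exact: gauss_fun_ge0.
rewrite integralT_gauss prodEFin prodr_const card_ord //.
Qed.

(** Absorbing the square into factor [i] keeps the integrand a product over the coordinates. *)
Lemma integral_sqr_std_weight (R : realType) n (i : 'I_n) :
  (\int[lebesgue_cV n]_z (z i ord0 ^+ 2 * std_weight (z : 'cV[R]_n))%:E =
   (Num.sqrt pi ^+ n / 2)%:E)%E.
Proof.
pose f (j : 'I_n) (t : R) :=
  if j == i then t ^+ 2 * gauss_fun t else gauss_fun t.
transitivity (\int[lebesgue_cV n]_z (\prod_j f j (z j ord0))%:E)%E.
  apply: eq_integral => z _; congr EFin.
  rewrite /std_weight (bigD1 i)//= [RHS](bigD1 i)//= /f eqxx mulrA.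
  by congr (_ * _); apply: eq_bigr => j /negbTE ->.
rewrite ge0_integral_prod; last 2 first.
- move=> j; rewrite /f; case: eqP => _; last exact: measurable_gauss_fun.
  by apply: measurable_funM => //; exact: measurable_gauss_fun.
- move=> j t; rewrite /f; case: eqP => _; last exact: gauss_fun_ge0.
  by apply: mulr_ge0; [exact: sqr_ge0|exact: gauss_fun_ge0].
rewrite (bigD1 i)//= /f eqxx integral_sqr_gauss.
under eq_bigr => j /negbTE -> do rewrite integralT_gauss.
rewrite prodEFin prodr_const -EFinM; congr EFin.
(* The [n.-1] unmodified factors and the modified one restore the power [n], which is positive
   because ['I_n] contains [i]. *)
rewrite mulrAC -exprS cardC1 card_ord prednK//.
exact: leq_ltn_trans (ltn_ord i).
Qed.

(** Appending 1 turns affine maps of [z] into linear ones, and lets a single second-moment matrix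
    record the second moments, the first moments and the total mass. *)
Definition homogeneous_cV (R : realType) n (z : 'cV[R]_n) : 'cV[R]_(n + 1) :=
  col_mx z 1%:M.

Section standardized_moments.
Context d (T : measurableType d) (R : realType) (Pr : probability T R)
  (n : nat).
Variables (W : T -> 'cV[R]_n) (c : R).
Hypothesis mW : measurable_fun [set: T] W.
Hypothesis W_law : forall G : 'cV[R]_n -> \bar R,
  measurable_fun [set: 'cV[R]_n] G -> (forall x, 0 <= G x)%E ->
  (\int[Pr]_w G (W w) =
   c%:E * \int[lebesgue_cV n]_z (G z * (std_weight (z : 'cV[R]_n))%:E))%E.

Let c_mass : c * Num.sqrt pi ^+ n = 1.
Proof.
have := @W_law (cst 1%E) (measurable_cst _) (fun=> lee01).
rewrite integral_cst//= mul1e probability_setT.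
under eq_integral do rewrite mul1e.
by rewrite integral_std_weight -EFinM => -[].
Qed.

Let measurable_sqr_entry (i : 'I_n) :
  measurable_fun [set: 'cV[R]_n] (fun z => (z i ord0 ^+ 2)%:E).
Proof.
apply/measurable_EFinP; apply: measurable_funX; exact: measurable_entry.
Qed.

Lemma integral_sqr_std i : (\int[Pr]_w (W w i ord0 ^+ 2)%:E = (2^-1)%:E)%E.
Proof.
rewrite (W_law (measurable_sqr_entry i)); last first.
  by move=> z; rewrite lee_fin sqr_ge0.
under eq_integral do rewrite -EFinM.
by rewrite integral_sqr_std_weight -EFinM mulrA c_mass mul1r.
Qed.

(** The reflection exchanges the positive and negative parts of [G] and preserves the weight. The
    split into parts is made because [W_law] speaks of nonnegative functions. *)
Lemma integral_odd_std (i : 'I_n) (G : 'cV[R]_n -> R) :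
  measurable_fun [set: 'cV[R]_n] G ->
  (forall z, G (reflect_cV i z) = - G z) ->
  Pr.-integrable [set: T] (fun w => (G (W w))%:E) ->
  (\int[Pr]_w (G (W w))%:E = 0)%E.
Proof.
move=> mG oddG iG; rewrite integralE.
have mEG : measurable_fun [set: 'cV[R]_n] (EFin \o G) by exact/measurable_EFinP.
have -> : (\int[Pr]_x (fun w => (G (W w))%:E)^\- x =
           \int[Pr]_x (fun w => (G (W w))%:E)^\+ x)%E.
  have -> : (fun w => (G (W w))%:E) = (EFin \o G) \o W by [].
  rewrite funepos_comp funeneg_comp.
  rewrite (@W_law (EFin \o G)^\-%E)//; last exact: measurable_funeneg.
  rewrite (@W_law (EFin \o G)^\+%E)//; last exact: measurable_funepos.
  congr (_ * _)%E.
  rewrite (ge0_integral_reflect i); last 2 first.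
  - apply: emeasurable_funM; first exact: measurable_funeneg.
    by apply/measurable_EFinP; apply: measurable_std_weight.
  - by move=> z; rewrite mule_ge0// lee_fin std_weight_ge0.
  apply: eq_integral => z _; congr (_ * _%:E)%E.
    by rewrite funenegE funeposE/= oddG opprK.
  apply: eq_bigr => j _; rewrite /gauss_fun mxE.
  by case: ifP => // _; rewrite sqrrN.
(* Integrability makes the common value finite, which excludes a difference of infinities. *)
by rewrite subee// integrable_pos_fin_num.
Qed.

Let homogeneousE (z : 'cV[R]_n) k : homogeneous_cV z k ord0 =
  if fintype.split k is inl i then z i ord0 else 1.
Proof.
rewrite -{1}(splitK k) /homogeneous_cV; case: (fintype.split k) => i /=.
  by rewrite col_mxEu.
by rewrite col_mxEd ord1 mxE eqxx.
Qed.

Let measurable_homogeneous k :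
  measurable_fun [set: 'cV[R]_n] (fun z => homogeneous_cV z k ord0).
Proof.
under eq_fun do rewrite homogeneousE.
by case: (fintype.split k) => i;
  [exact: measurable_entry|exact: measurable_cst].
Qed.

(** With the sign written as a power of -1 with boolean exponent, the sign of a product of two
    entries is governed by an exclusive or. *)
Let homogeneous_reflect (i : 'I_n) (z : 'cV[R]_n) k :
  homogeneous_cV (reflect_cV i z) k ord0 =
  (-1) ^+ (k == lshift 1 i) * homogeneous_cV z k ord0.
Proof.
rewrite !homogeneousE; case: split_ordP => j ->; last first.
  by rewrite eq_rlshift mul1r.
by rewrite mxE eq_lshift; case: eqP => _; rewrite ?mulN1r ?mul1r.
Qed.

Let V w := homogeneous_cV (W w).

Let integrable_sqr_homogeneous k :
  Pr.-integrable [set: T] (fun w => (V w k ord0 ^+ 2)%:E).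
Proof.
have mk : measurable_fun [set: T] (fun w => (V w k ord0 ^+ 2)%:E).
  apply/measurable_EFinP; apply: measurable_funX.
  exact: measurableT_comp (measurable_homogeneous k) mW.
apply/integrableP; split => //.
under eq_integral do rewrite gee0_abs ?lee_fin ?sqr_ge0//.
under eq_integral do rewrite homogeneousE.
case: (fintype.split k) => i; first by rewrite integral_sqr_std ltry.
by rewrite expr1n integral_cst//= mul1e probability_setT ltry.
Qed.

(** Domination through |a b| <= a^2 + b^2. *)
Let integrable_homogeneous k l :
  Pr.-integrable [set: T] (fun w => (V w k ord0 * V w l ord0)%:E).
Proof.
apply: (le_integrable _ _ _ (integrableD measurableT
  (integrable_sqr_homogeneous k) (integrable_sqr_homogeneous l))) => //.
  apply/measurable_EFinP; apply: measurable_funM;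
  exact: measurableT_comp (measurable_homogeneous _) mW.
move=> w _; rewrite -EFinD !abse_EFin lee_fin.
move: (homogeneous_cV _ _ _) (homogeneous_cV _ _ _) => a b.
rewrite [leRHS]ger0_norm ?addr_ge0 ?sqr_ge0// ler_norml; nra.
Qed.

Lemma second_moment_std :
  let VVT w := homogeneous_cV (W w) *m (homogeneous_cV (W w))^T in
  integrable_mx Pr VVT /\ expectation_mx Pr VVT = block_mx (2^-1)%:M 0 0 1%:M.
Proof.
have VVTE w k l : ((V w *m (V w)^T) k l)%:E =
    (V w k ord0 * V w l ord0)%:E.
  by rewrite [in LHS]mxE big_ord1; congr (_ * _)%:E; rewrite [LHS]mxE.
split=> [k l|].
  by under eq_fun do rewrite VVTE; exact: integrable_homogeneous.
(* When exactly one of the two indices is that of coordinate [i], the entry is odd under its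
   reflection. This covers the mixed second moments and, the last entry of [V w] being 1, the first
   moments. *)
have odd i k l : (k == lshift 1 i) (+) (l == lshift 1 i) ->
    (\int[Pr]_w ((V w *m (V w)^T) k l)%:E = 0)%E.
  move=> kl; under eq_integral do rewrite VVTE.
  apply: (@integral_odd_std i
    (fun z => homogeneous_cV z k ord0 * homogeneous_cV z l ord0)).
  - by apply: measurable_funM; exact: measurable_homogeneous.
  - by move=> z; rewrite !homogeneous_reflect mulrACA -signr_addb kl mulN1r.
  - exact: integrable_homogeneous.
apply: expectation_mxE => k l.
case: (split_ordP k) => i ->; case: (split_ordP l) => j ->.
- rewrite block_mxEul mxE; have [<-|ij] := eqVneq i j.
    rewrite mulr1n -(integral_sqr_std i); apply: eq_integral => w _.
    by rewrite VVTE homogeneousE; case: split_ordP => i' /eqP;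
      rewrite ?eq_lrshift // eq_lshift => /eqP <-; rewrite expr2.
  by rewrite (odd i)// eqxx eq_lshift eq_sym (negbTE ij).
- by rewrite block_mxEur mxE (odd i)// eqxx eq_rlshift.
- by rewrite block_mxEdl mxE (odd j)// eqxx eq_rlshift.
- rewrite block_mxEdr !ord1 mxE eqxx.
  under eq_integral do rewrite VVTE homogeneousE.
  case: split_ordP => i' /eqP; rewrite ?eq_rlshift// => _.
  by rewrite mulr1 integral_cst//= mul1e probability_setT.
Qed.

End standardized_moments.

(** * The second moment of the stacked vector and its block factor *)

Lemma gaussian_second_moment d (T : measurableType d) (R : realType)
    (Pr : probability T R) n k (X : T -> 'cV[R]_n) (mu : 'cV[R]_n)
    (P : 'M[R]_n) (b : 'cV[R]_k) :
  posdefmx P -> measurable_fun [set: T] X ->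
  has_density Pr X (gaussian_pdf mu P) ->
  let Z := fun w => col_mx (X w) b in
  integrable_mx Pr (fun w => Z w *m (Z w)^T) /\
  expectation_mx Pr (fun w => Z w *m (Z w)^T) =
    block_mx (P + mu *m mu^T) (mu *m b^T) (b *m mu^T) (b *m b^T).
Proof.
move=> Ppd mX dX Z.
have [L [c [c0 Lu LLT W_law]]] := gaussian_standardize Ppd mX dX.
pose W w := invmx L *m (X w - mu).
have mW : measurable_fun [set: T] W.
  have -> : W = (fun z => - (invmx L *m mu) + invmx L *m z) \o X.
    by apply/funext => w /=; rewrite /W mulmxBr addrC.
  by apply: measurableT_comp mX; exact: measurable_affine_mx.
have [iV EV] := second_moment_std mW W_law.
(* As X = L W + mu, [B] maps the homogeneous vector of [W] to [Z]. Conjugating diag(I/2, 1) by [B]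
   then produces L L^T / 2 = P in the first block. *)
pose B : 'M[R]_(n + k, n + 1) := block_mx L mu 0 b.
have ZE : (fun w => Z w *m (Z w)^T) = (fun w =>
    B *m (homogeneous_cV (W w) *m (homogeneous_cV (W w))^T) *m B^T).
  apply/funext => w.
  suff -> : Z w = B *m homogeneous_cV (W w) by rewrite trmx_mul !mulmxA.
  by rewrite mul_block_col mul0mx add0r !mulmx1 mulKVmx// subrK.
have [iZ EZ] := integrable_expectation_congruence B iV.
rewrite ZE; split => //; rewrite EZ EV /B mulmx_block !mulmx0 !mul0mx !mulmx1.
rewrite !addr0 !add0r tr_block_mx trmx0 mulmx_block !mulmx0 !mul0mx.
rewrite !add0r mul_mx_scalar -scalemxAl LLT scalerA mulVf// scale1r.
by [].
Qed.

Unset Implicit Arguments.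
Set Strict Implicit.

Theorem lemma3p4 (R : realType) (nx nu ny p : nat)
    (d : measure_display) (T : measurableType d) (Pr : probability T R)
    (X0 X1 : {RV Pr >-> 'cV[R]_nx})
    (mu : 'cV[R]_(nx + nx)) (P : 'M[R]_(nx + nx))
    (sqrtP : 'M[R]_(p, nx + nx))
    (u : 'cV[R]_nu) (y : 'cV[R]_ny)
    (M11 : 'M[R]_(nx + nx)) :
  posdefmx P ->
  is_sqrt_factor P sqrtP ->
  has_density Pr (fun w => col_mx (X0 w) (X1 w)) (gaussian_pdf mu P) ->
  Qless_QR (col_mx sqrtP mu^T) M11 ->
  let lambda := (invmx M11)^T *m mu in
  let s := 1 - (lambda^T *m lambda) ord0 ord0 in
  let M12 := lambda *m row_mx u^T y^T in
  let M22 := Num.sqrt s *: row_mx u^T y^T in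
  let Z := fun w => col_mx (col_mx (X0 w) (X1 w)) (col_mx u y) in
  let ZZT := fun w => Z w *m (Z w)^T in
  [/\ M11 \in unitmx, 0 <= s, integrable_mx Pr ZZT
    & is_sqrt_factor (expectation_mx Pr ZZT) (block_mx M11 M12 0 M22)].
Proof.
move=> Ppd sqrtPE dX QR lambda s M12 M22 Z ZZT.
have gram : M11^T *m M11 = P + mu *m mu^T.
  by rewrite (Qless_QR_gram QR) augmented_gram sqrtPE.
have Ku := posdefmx_unit (posdefmx_rank1 mu Ppd).
have M11u : M11 \in unitmx by move: Ku; rewrite -gram unitmx_mul => /andP[].
have M11lambda : M11^T *m lambda = mu.
  by rewrite /lambda mulmxA -trmx_mul mulVmx// trmx1 mul1mx.
(* The Gram identity inverts to K^-1 = M11^-1 M11^-T for K = P + mu mu^T, which brings lambda^T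
   lambda to the form bounded by [rank1_update_le1]. *)
have lambda2 : lambda^T *m lambda = mu^T *m invmx (P + mu *m mu^T) *m mu.
  have -> : invmx (P + mu *m mu^T) = invmx M11 *m (invmx M11)^T.
    apply: (can_inj (mulKmx Ku)); rewrite mulmxV// -gram -mulmxA mulKVmx//.
    by rewrite -trmx_mul mulVmx// trmx1.
  by rewrite /lambda trmx_mul trmxK !mulmxA.
have s0 : 0 <= s by rewrite subr_ge0 lambda2 rank1_update_le1.
have mX : measurable_fun [set: T] (fun w => col_mx (X0 w) (X1 w)).
  apply/measurable_fun_matrixP => i j; under eq_fun do rewrite mxE.
  by case: (fintype.split i) => k;
    apply: (measurableT_comp (@measurable_entry _ _ _ _ _ _));
    exact: measurable_funP.
have [iZ EZ] := gaussian_second_moment (col_mx u y) Ppd mX dX.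
split => //; rewrite /is_sqrt_factor EZ.
have bT : row_mx u^T y^T = (col_mx u y)^T by rewrite tr_col_mx.
rewrite tr_block_mx mulmx_block trmx0 !mulmx0 !mul0mx !addr0 gram.
rewrite /M12 /M22 bT; set b := col_mx u y.
rewrite mulmxA M11lambda trmx_mul trmxK -mulmxA.
have -> : lambda^T *m M11 = mu^T.
  by rewrite -[in RHS]M11lambda [RHS]trmx_mul trmxK.
(* Only the lower right block remains: [M12] contributes lambda^T lambda and [M22] contributes [s]
   as coefficients of b b^T, and these add up to 1. *)
congr block_mx.
have -> : (Num.sqrt s *: b^T)^T = Num.sqrt s *: b.
  by apply/matrixP => i j; rewrite !mxE.
(* [Num.sqrt] is 0 on negative numbers, so recovering [s] from its square relies on [s0]. *)
rewrite -scalemxAl -scalemxAr scalerA -expr2 sqr_sqrtr//.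
rewrite -mulmxA (mulmxA lambda^T) [lambda^T *m lambda]mx11_scalar.
rewrite mul_scalar_mx -scalemxAr -scalerDl /s addrC subrK.
by rewrite scale1r.
Qed.
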